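(* Let $E,Z$ be Banach spaces, $K\subset Z$ a closed convex cone with nonempty interior, $X\subset E$ convex, $f:X\to\mathbb{R}$ convex and $g:X\to Z$ $K$-convex. Consider the problem (P): minimize $f(x)$ subject to $x\in X$, $g(x)\preceq_K0$, and let $v(z):=\inf\{f(x):x\in X,\ g(x)\preceq_K z\}$ for $z\in Z$. Suppose that (P) has an optimal solution. Then the following statements are equivalent: (i) The set of all optimal Lagrange multipliers for (P) is nonempty. (ii) $\partial v(0)$ is nonempty. (iii) $v(0)$ is finite and there exists $M\in(0,+\infty)$ such that $v(0)-v(z)\le M\|z\|$ for all $z\in Z$.
   Context: Order notation: $z_1\preceq_K z_2$ means $z_2-z_1\in K$. $g$ is $K$-convex if $g(\lambda x_1+(1-\lambda)x_2)\preceq_K\lambda g(x_1)+(1-\lambda)g(x_2)$ for all $x_1,x_2\in X$, $\lambda\in[0,1]$. $Z^*$ is the topological dual and $K^+:=\{z^*\in Z^*:\langle z^*,z\rangle\ge0\ \forall z\in K\}$. A pair $(\bar x,\bar u^* )\in X\times Z^*$ satisfies the optimality conditions for (P) if: (i) $f(\bar x)+\langle\bar u^*,g(\bar x)\rangle=\min_{x\in X}\{f(x)+\langle\bar u^*,g(x)\rangle\}$; (ii) $\langle\bar u^*,g(\bar x)\rangle=0$; (iii) $\bar u^*\in K^+$; (iv) $g(\bar x)\preceq_K0$. $\bar u^*\in Z^*$ is an optimal Lagrange multiplier for (P) if $(\bar x,\bar u^* )$ satisfies the optimality conditions for some $\bar x\in X$. Convention $\inf\emptyset=+\infty$; $v$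 takes values in $\mathbb{R}\cup\{\pm\infty\}$. For $v(0)\in\mathbb{R}$, $\partial v(0):=\{z^*\in Z^*:\langle z^*,z\rangle\le v(z)-v(0)\ \forall z\in Z\}$. *)

(* Defs.v *)
From HB Require Import structures.
From mathcomp Require Import all_boot all_order all_algebra.
From mathcomp Require Import all_classical all_reals all_analysis.

Set Implicit Arguments.
Unset Strict Implicit.
Unset Printing Implicit Defensive.

Import Order.TTheory GRing.Theory Num.Theory.
Import numFieldNormedType.Exports.

Local Open Scope classical_set_scope.
Local Open Scope ring_scope.

(* Functions defined on a convex set X `<=` E are represented by total
   functions on E; every definition below only looks at their values on X. *)

Definition cone (R : realType) (Z : normedModType R) (K : set Z) : Prop :=
  forall (t : R) (z : Z), 0 <= t -> K z -> K (t *: z).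

Definition preceq (R : realType) (Z : normedModType R) (K : set Z)
    (z1 z2 : Z) : Prop :=
  K (z2 - z1).

Definition cone_convex (R : realType) (E Z : normedModType R) (K : set Z)
    (X : set E) (g : E -> Z) : Prop :=
  forall (x1 x2 : E) (t : R), X x1 -> X x2 -> 0 <= t <= 1 ->
    preceq K (g (t *: x1 + (1 - t) *: x2)) (t *: g x1 + (1 - t) *: g x2).

Definition topological_dual (R : realType) (Z : normedModType R) :
    set {linear Z -> R^o} :=
  [set u | continuous u].

Definition dual_cone (R : realType) (Z : normedModType R) (K : set Z) :
    set {linear Z -> R^o} :=
  [set u | topological_dual u /\ forall z, K z -> 0 <= u z].

Definition feasible (R : realType) (E Z : normedModType R) (K : set Z)
    (X : set E) (g : E -> Z) (z : Z) : set E :=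
  [set x | X x /\ preceq K (g x) z].

Definition optimal_solution (R : realType) (E Z : normedModType R) (K : set Z)
    (X : set E) (f : E -> R) (g : E -> Z) : set E :=
  [set x | feasible K X g 0 x /\ forall y, feasible K X g 0 y -> f x <= f y].

Definition value_function (R : realType) (E Z : normedModType R) (K : set Z)
    (X : set E) (f : E -> R) (g : E -> Z) (z : Z) : \bar R :=
  ereal_inf [set (f x)%:E | x in feasible K X g z].

Definition optimality_conditions (R : realType) (E Z : normedModType R)
    (K : set Z) (X : set E) (f : E -> R) (g : E -> Z)
    (x : E) (u : {linear Z -> R^o}) : Prop :=
  [/\ X x /\ (forall y, X y -> f x + u (g x) <= f y + u (g y)),
      u (g x) = 0,
      dual_cone K u &
      preceq K (g x) 0].

Definition optimal_multipliers (R : realType) (E Z : normedModType R)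
    (K : set Z) (X : set E) (f : E -> R) (g : E -> Z) :
    set {linear Z -> R^o} :=
  [set u | topological_dual u /\
           exists x : E, optimality_conditions K X f g x u].

(* The subdifferential at 0 is only meant for v 0 finite; it is taken to be
   empty otherwise. *)
Definition subdifferential0 (R : realType) (Z : normedModType R)
    (v : Z -> \bar R) : set {linear Z -> R^o} :=
  [set u | [/\ v 0 \is a fin_num,
               topological_dual u &
               forall z, ((u z)%:E <= v z - v 0%R)%E]].

(* Main.v *)
(** Multipliers are the negatives of subgradients of v at 0, and a continuous
    subgradient is bounded, which gives (i) => (ii) => (iii).  For
    (iii) => (i), the set of (w, r) such that some x in X satisfies
    g x <=_K w and f x - v(0) <= r is convex and lies above -M |w|.
    Hahn-Banach provides a continuous linear u with u w <= r on this set;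
    testing it on (k, 0) for k in K, on (g x0, 0) for the optimal solution x0,
    and on (g x, f x - v(0)) shows that -u is an optimal multiplier. *)

Require Import Defs.
From HB Require Import structures.
From mathcomp Require Import all_boot all_order all_algebra.
From mathcomp Require Import all_classical all_reals all_analysis.
From mathcomp Require Import ring lra.

Set Implicit Arguments.
Unset Strict Implicit.
Unset Printing Implicit Defensive.

Import Order.TTheory GRing.Theory Num.Theory.
Import numFieldNormedType.Exports.

Local Open Scope classical_set_scope.
Local Open Scope ring_scope.

(** * Sublinear functionals and the Hahn-Banach theorem *)

(** One inequality suffices for positive homogeneity: applying it with the inverse of [t] gives the
    other. *)
Definition sublinear (R : realType) (V : lmodType R) (q : V -> R) : Prop :=
  (forall x y, q (x + y) <= q x + q y) /\
  (forall t x, 0 < t -> q (t *: x) <= t * q x).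

Lemma sublinear0 (R : realType) (V : lmodType R) (q : V -> R) :
  sublinear q -> q 0 = 0.
Proof.
move=> [qD qZ]; have := qD 0 0; have := qZ 2^-1 0.
by rewrite addr0 scaler0 => /(_ ltac:(lra)); lra.
Qed.

Lemma sublinearN (R : realType) (V : lmodType R) (q : V -> R) (x : V) :
  sublinear q -> - q (- x) <= q x.
Proof.
move=> sq; have [qD _] := sq.
by have := qD x (- x); rewrite subrr sublinear0//; lra.
Qed.

Section infimum.
Variables (R : realType) (V : lmodType R) (S : V -> set R).
Hypothesis S_neq0 : forall x, S x !=set0.
Hypothesis S0_ge0 : forall a, S 0 a -> 0 <= a.
Hypothesis S_add : forall x y a b, S x a -> S y b ->
  exists2 c, S (x + y) c & c <= a + b.
Hypothesis S_scale : forall x a t, S x a -> 0 < t ->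
  exists2 c, S (t *: x) c & c <= t * a.

(** Any [b] in [S (- x)] yields the lower bound [- b], because [a + b] lies above an element of
    [S 0]. *)
Lemma infimum_has_lbound (x : V) : has_lbound (S x).
Proof.
have [b Sb] := S_neq0 (- x).
exists (- b) => a /S_add /(_ Sb)[c]; rewrite subrr => /S0_ge0; lra.
Qed.

Lemma infimum_le (x : V) (a : R) : S x a -> inf (S x) <= a.
Proof. exact/ge_inf/infimum_has_lbound. Qed.

(** Common source of the sublinear functionals built below: [S x] collects candidate values at [x],
    and only domination up to an inequality is asked of sums and multiples. *)
Lemma sublinear_infimum : sublinear (fun x => inf (S x)).
Proof.
split=> [x y|t x t0].
- suff : forall a b, S x a -> S y b -> inf (S (x + y)) <= a + b.
    move=> H; rewrite -lerBlDr; apply: lb_le_inf => // a Sa.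
    rewrite lerBlDr -lerBlDl; apply: lb_le_inf => // b Sb.
    by rewrite lerBlDl; exact: H.
  move=> a b Sa Sb; have [c Sc] := S_add Sa Sb.
  by apply: le_trans; exact: infimum_le.
- rewrite -ler_pdivrMl//; apply: lb_le_inf => // a Sa.
  have [c Sc] := S_scale Sa t0; rewrite ler_pdivrMl//.
  by apply: le_trans; exact: infimum_le.
Qed.

End infimum.

(* A minimal sublinear functional q is additive: for fixed y, the functional
   x |-> inf_(t >= 0) (q (x + t y) - t q y) is sublinear and below q, hence
   equals q, and its value is at most q (x + y) - q y. *)
Lemma minimal_sublinear_additive (R : realType) (V : lmodType R) (q : V -> R) :
  sublinear q ->
  (forall r, sublinear r -> (forall x, r x <= q x) -> forall x, q x <= r x) ->
  forall x y, q (x + y) = q x + q y.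
Proof.
move=> sq qmin x y; have [qD qZ] := sq; apply/eqP; rewrite eq_le qD/=.
pose S z := [set q (z + t *: y) - t * q y | t in [set t | 0 <= t]].
have S_neq0 z : S z !=set0 by exists (q (z + 0 *: y) - 0 * q y); exists 0 => /=.
have S0_ge0 a : S 0 a -> 0 <= a.
  move=> [t /= t0 <-]; rewrite add0r.
  have := t0; rewrite le_eqVlt => /predU1P[<-|tgt0].
    by rewrite scale0r sublinear0// mul0r subr0.
  have := qZ t^-1 (t *: y); rewrite invr_gt0 => /(_ tgt0).
  by rewrite scalerA mulVf ?gt_eqF// scale1r ler_pdivlMl// subr_ge0.
have S_add u w a b : S u a -> S w b -> exists2 c, S (u + w) c & c <= a + b.
  move=> [s /= s0 <-] [t /= t0 <-].
  exists (q (u + w + (s + t) *: y) - (s + t) * q y).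
    by exists (s + t) => //=; rewrite addr_ge0.
  have := qD (u + s *: y) (w + t *: y).
  by rewrite addrACA -scalerDl; lra.
have S_scale u a t : S u a -> 0 < t -> exists2 c, S (t *: u) c & c <= t * a.
  move=> [s /= s0 <-] t0.
  exists (q (t *: u + (t * s) *: y) - (t * s) * q y).
    by exists (t * s) => //=; rewrite mulr_ge0// ltW.
  by have := qZ t (u + s *: y) t0; rewrite scalerDr scalerA; lra.
have := qmin _ (sublinear_infimum S_neq0 S0_ge0 S_add S_scale).
have Sle z t : 0 <= t -> inf (S z) <= q (z + t *: y) - t * q y.
  by move=> t0; apply: infimum_le => //; exists t.
move=> /(_ _ x)/le_trans; rewrite -lerBrDr; apply.
  by move=> z; have := Sle z 0; rewrite scale0r mul0r subr0 addr0; exact.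
by have := Sle x 1; rewrite scale1r mul1r; exact.
Qed.

(** The pointwise infimum works: of two comparable functionals, the smaller one bounds both
    summands, which gives subadditivity. *)
Lemma chain_infimum_sublinear (R : realType) (V : lmodType R)
    (A : set (V -> R)) :
  A !=set0 -> (forall q, A q -> sublinear q) ->
  (forall q r, A q -> A r -> (forall x, q x <= r x) \/ (forall x, r x <= q x)) ->
  exists2 r, sublinear r & forall q, A q -> forall x, r x <= q x.
Proof.
move=> [q0 Aq0] Asub Atot.
pose S z := [set q z | q in A].
have S_neq0 z : S z !=set0 by exists (q0 z); exists q0.
have S0_ge0 a : S 0 a -> 0 <= a.
  by move=> [q Aq <-]; rewrite sublinear0//; exact: Asub.
have S_add u w a b : S u a -> S w b -> exists2 c, S (u + w) c & c <= a + b.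
  move=> [q Aq <-] [r Ar <-]; have [/(_ w)|/(_ u)] := Atot _ _ Aq Ar.
    exists (q (u + w)); first by exists q.
    by have [qD _] := Asub _ Aq; rewrite (le_trans (qD _ _))// lerD2l.
  exists (r (u + w)); first by exists r.
  by have [rD _] := Asub _ Ar; rewrite (le_trans (rD _ _))// lerD2r.
have S_scale u a t : S u a -> 0 < t -> exists2 c, S (t *: u) c & c <= t * a.
  move=> [q Aq <-] t0; exists (q (t *: u)); first by exists q.
  by have [_ qZ] := Asub _ Aq; exact: qZ.
exists (fun x => inf (S x)); first exact: sublinear_infimum.
by move=> q Aq x; apply: infimum_le => //; exists q.
Qed.

Lemma exists_minimal_sublinear (R : realType) (V : lmodType R) (p : V -> R) :
  sublinear p ->
  exists q, [/\ sublinear q, forall x, q x <= p x &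
    forall r, sublinear r -> (forall x, r x <= q x) -> forall x, q x <= r x].
Proof.
move=> sp.
pose T := {q : V -> R | sublinear q /\ forall x, q x <= p x}.
have pp : sublinear p /\ forall x, p x <= p x by split.
(* The order is reversed, so that a maximal element in Zorn's lemma is a minimal functional. *)
pose rel_ge (q r : T) := `[< forall x, sval r x <= sval q x >].
have := @ZL_preorder T (exist _ p pp) rel_ge.
case=> [|q r s /asboolP qr /asboolP rs|A Atot|q qmin].
- by move=> q; apply/asboolP.
- by apply/asboolP => x; exact: le_trans (rs x) (qr x).
(* The empty chain is bounded by [p] itself. *)
- have [[q0 Aq0]|A0] := pselect (A !=set0); last first.
    by exists (exist _ p pp) => q Aq; exfalso; apply: A0; exists q.
  have [|||r sr rA] := @chain_infimum_sublinear R V [set sval q | q in A].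
  + by exists (sval q0); exists q0.
  + by move=> _ [q _ <-]; exact: (svalP q).1.
  + move=> _ _ [q Aq <-] [r Ar <-].
    by have [/asboolP|/asboolP] := Atot _ _ Aq Ar; [right|left].
  + have rp : sublinear r /\ forall x, r x <= p x.
      split=> // x; apply: le_trans ((svalP q0).2 x).
      by apply: rA; exists q0.
    exists (exist _ r rp) => q Aq; apply/asboolP => x /=.
    by apply: rA; exists q.
- have [sq qp] := svalP q; exists (sval q); split => // r sr rq.
  have rp : sublinear r /\ forall x, r x <= p x.
    by split=> // x; exact: le_trans (rq x) (qp x).
  by have /asboolP := qmin (exist _ r rp) (asboolT rq).
Qed.

(** A minimal sublinear functional below [p] is additive, hence odd, and oddness extends homogeneity
    to all scalars. *)
Lemma hahn_banach (R : realType) (V : lmodType R) (p : V -> R) :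
  sublinear p -> exists u : {linear V -> R^o}, forall x, u x <= p x.
Proof.
move=> /exists_minimal_sublinear[q [sq qp qmin]].
have qD := minimal_sublinear_additive sq qmin.
have [_ qZ] := sq.
have qN x : q (- x) = - q x.
  by apply/eqP; rewrite -addr_eq0 -qD addNr sublinear0.
have qZ_gt0 t x : 0 < t -> q (t *: x) = t * q x.
  move=> t0; apply/eqP; rewrite eq_le qZ//=.
  by have := qZ t (- x) t0; rewrite scalerN !qN mulrN lerN2.
have qlin : linear (q : V -> R^o).
  move=> t x y; rewrite qD; congr (_ + _).
  have [t0|t0|->] := ltgtP t 0.
  - by rewrite -[t]opprK scaleNr qN qZ_gt0 ?oppr_gt0// scaleNr.
  - exact: qZ_gt0.
  - by rewrite !scale0r sublinear0.
pose u : {linear V -> R^o} := HB.pack (q : V -> R^o)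
  (GRing.isLinear.Build _ _ _ _ (q : V -> R^o) qlin).
by exists u.
Qed.

(** * Continuous functionals and separation under a calmness bound *)

(** The one-sided bound at [- x] also controls [- u x]. *)
Lemma linear_le_norm_continuous (R : realType) (V : normedModType R)
    (u : {linear V -> R^o}) (M : R) :
  (forall x, u x <= M * `|x|) -> continuous u.
Proof.
move=> uM; apply/linear_bounded_continuous/linear_boundedP.
near=> r => x.
have Mr : M * `|x| <= r * `|x|.
  by apply: ler_wpM2r => //; near: r; exact: nbhs_pinfty_ge.
rewrite ler_norml (le_trans (uM x) Mr) andbT lerNl -linearN.
by apply: le_trans Mr; rewrite -[X in M * X]normrN.
Unshelve. all: by end_near. Qed.

Lemma continuous_linear_norm_bound (R : realType) (V : normedModType R)
    (u : {linear V -> R^o}) :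
  continuous u -> exists2 M, 0 < M & forall x, `|u x| <= M * `|x|.
Proof.
by move=> /linear_bounded_continuous/linear_boundedP/pinfty_ex_gt0.
Qed.

(* Infimal convolution of the norm with the conical hull of G produces a
   sublinear functional, finite everywhere thanks to the calmness bound. *)
Lemma calm_subgradient (R : realType) (V : normedModType R)
    (G : V -> R -> Prop) (M : R) :
  0 <= M -> G 0 0 ->
  (forall w1 r1 w2 r2 t, G w1 r1 -> G w2 r2 -> 0 <= t <= 1 ->
     G (t *: w1 + (1 - t) *: w2) (t * r1 + (1 - t) * r2)) ->
  (forall w r, G w r -> - (M * `|w|) <= r) ->
  exists u : {linear V -> R^o},
    continuous u /\ forall w r, G w r -> u w <= r.
Proof.
move=> M0 G0 Gconv Gcalm.
pose S d := [set a | exists t w r,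
  [/\ 0 < t, G w r & a = t * r + M * `|d - t *: w| ]].
have S_neq0 d : S d !=set0.
  by exists (1 * 0 + M * `|d - 1 *: 0|), 1, 0, 0.
have S0_ge0 a : S 0 a -> 0 <= a.
  (* At [d = 0] the candidate value is [t * (r + M * |w|)]. *)
  move=> [t [w [r [t0 Gwr ->]]]]; rewrite sub0r normrN normrZ gtr0_norm//.
  by rewrite mulrCA -mulrDr mulr_ge0 ?(ltW t0)//; have := Gcalm _ _ Gwr; lra.
have S_add d1 d2 a b : S d1 a -> S d2 b -> exists2 c, S (d1 + d2) c & c <= a + b.
  move=> [s [w1 [r1 [s0 G1 ->]]]] [t [w2 [r2 [t0 G2 ->]]]].
  have st0 : 0 < s + t by rewrite addr_gt0.
  (* Weights chosen so that [s + t] times the convex combination of [w1], [w2] is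
     [s *: w1 + t *: w2]. *)
  have stE : 1 - s / (s + t) = t / (s + t) by field; rewrite gt_eqF.
  have st01 : 0 <= s / (s + t) <= 1.
    by rewrite divr_ge0 ?(ltW s0) ?(ltW st0)//= ler_pdivrMr// mul1r lerDl ltW.
  have stK c : (s + t) * (c / (s + t)) = c by field; rewrite gt_eqF.
  have := Gconv _ _ _ _ _ G1 G2 st01; rewrite stE => G12.
  set w := (X in G X _) in G12; set r := (X in G _ X) in G12.
  exists ((s + t) * r + M * `|d1 + d2 - (s + t) *: w|).
    by exists (s + t), w, r.
  rewrite /w /r scalerDr !scalerA !stK mulrDr !(mulrA (s + t) (_ / _)) !stK.
  rewrite opprD (addrACA d1) (addrACA (s * r1)) lerD2l -mulrDr.
  by rewrite ler_wpM2l// ler_normD.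
have S_scale d a s : S d a -> 0 < s -> exists2 c, S (s *: d) c & c <= s * a.
  move=> [t [w [r [t0 Gwr ->]]]] s0.
  exists (s * t * r + M * `|s *: d - (s * t) *: w|).
    by exists (s * t), w, r; rewrite mulr_gt0.
  by rewrite -scalerA -scalerBr normrZ gtr0_norm//; lra.
have [u uS] := hahn_banach (sublinear_infimum S_neq0 S0_ge0 S_add S_scale).
have Sle d a : S d a -> u d <= a.
  by move=> Sa; apply: le_trans (uS d) _; exact: infimum_le.
exists u; split.
  (* The point [(0, 0)] of [G] gives [u d <= M * |d|]. *)
  apply: (@linear_le_norm_continuous _ _ _ M) => d; apply: Sle.
  by exists 1, 0, 0; split => //; rewrite mulr0 add0r scaler0 subr0.
(* At [d = w] with [t = 1] the norm term vanishes. *)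
move=> w r Gwr; apply: Sle; exists 1, w, r; split => //.
by rewrite mul1r scale1r subrr normr0 mulr0 addr0.
Qed.

(** * Convexity with plain real coefficients *)

Lemma convex_setP (R : realType) (E : lmodType R) (X : set E) :
  convex_set X -> forall x y t, X x -> X y -> 0 <= t <= 1 ->
  X (t *: x + (1 - t) *: y).
Proof.
move=> Xconv x y t Xx Xy /andP[t0 t1].
exact: set_mem (Xconv x y (Itv01 t0 t1) (mem_set Xx) (mem_set Xy)).
Qed.

(** The sum is twice the midpoint. *)
Lemma convex_cone_add (R : realType) (Z : normedModType R) (K : set Z)
    (a b : Z) :
  convex_set K -> cone K -> K a -> K b -> K (a + b).
Proof.
move=> Kconv Kcone Ka Kb.
have h : 0 <= (2^-1 : R) <= 1 by apply/andP; split; lra.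
have := Kcone 2 _ (ler0n _ 2) (convex_setP Kconv Ka Kb h).
have -> : (1 - 2^-1 : R) = 2^-1 by lra.
by rewrite scalerDr !scalerA divff ?pnatr_eq0// !scale1r.
Qed.

Lemma convex_functionP (R : realType) (E : lmodType R) (X : set E)
    (f : E -> R) :
  convex_function X f -> forall x y t, X x -> X y -> 0 <= t <= 1 ->
  f (t *: x + (1 - t) *: y) <= t * f x + (1 - t) * f y.
Proof.
move=> fconv x y t Xx Xy /andP[t0 t1].
exact: fconv (Itv01 t0 t1) x y (mem_set Xx) (mem_set Xy).
Qed.

(** * Multipliers, subgradients and calmness *)

Section duality.
Variables (R : realType) (E Z : completeNormedModType R).
Variables (K : set Z) (X : set E) (f : E -> R) (g : E -> Z).

Lemma value_function_solution (x : E) : optimal_solution K X f g x ->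
  value_function K X f g 0 = (f x)%:E.
Proof.
move=> [xF xmin]; apply/eqP; rewrite eq_le; apply/andP; split.
  by apply: ereal_inf_lbound; exists x.
by apply: le_ereal_inf_tmp => _ [y yF <-]; rewrite lee_fin xmin.
Qed.

Lemma value_function_le (z : Z) (x : E) : X x -> K (z - g x) ->
  (value_function K X f g z <= (f x)%:E)%E.
Proof. by move=> Xx Kx; apply: ereal_inf_lbound; exists x. Qed.

(** Weak duality: if [y] is feasible for [z], then [f x0 <= f x <= f y + u (g y) <= f y + u z], by
    optimality of [x0], minimality of the Lagrangian at [x], and positivity of [u] on [K]. *)
Lemma multiplier_subgradient (x0 : E) (u : {linear Z -> R^o}) :
  optimal_solution K X f g x0 -> optimal_multipliers K X f g u ->
  subdifferential0 (value_function K X f g) (\- u : {linear Z -> R^o}).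
Proof.
move=> x0opt [ucont [x [[Xx xmin] ux0 [_ uK] xK]]].
have v0 := value_function_solution x0opt.
have xopt : f x <= f x0.
  have [[Xx0 x0K] _] := x0opt.
  have := xmin _ Xx0; have := uK _ x0K; rewrite ux0 sub0r linearN; lra.
split; rewrite ?v0//.
  by move=> z; apply: cvgN; exact: ucont.
move=> z; rewrite leeBrDr// -EFinD; apply: le_ereal_inf_tmp => _ [y [Xy yK] <-].
rewrite lee_fin /=; have := uK _ yK; have := xmin _ Xy.
have [_ /(_ x)] := x0opt; move/(_ (conj Xx xK)).
rewrite ux0 linearB/=; lra.
Qed.

Lemma subgradient_calm (v : Z -> \bar R) (u : {linear Z -> R^o}) :
  subdifferential0 v u ->
  exists2 M : R, 0 < M & forall z : Z, (v 0%R - v z <= (M * `|z|)%:E)%E.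
Proof.
move=> [v0 /continuous_linear_norm_bound[M M0 uM] uv]; exists M => // z.
have := uv z; have := uM z; rewrite -[v 0](fineK v0).
move/ler_normlP => [uzM _].
(* For [v z = +oo] the claim is trivial; [v z = -oo] contradicts the subgradient inequality. *)
case: (v z) => [r| |]; rewrite ?leNye//= -?EFinB ?lee_fin//; lra.
Qed.

Lemma calm_multiplier (x0 : E) (M : R) :
  convex_set K -> cone K -> convex_set X -> convex_function X f ->
  cone_convex K X g -> optimal_solution K X f g x0 -> 0 < M ->
  (forall z : Z, (value_function K X f g 0%R - value_function K X f g z
     <= (M * `|z|)%:E)%E) ->
  optimal_multipliers K X f g !=set0.
Proof.
move=> Kconv Kcone Xconv fconv gconv x0opt M0 calm.
have v0 := value_function_solution x0opt; have [[Xx0 x0K] _] := x0opt.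
have Kadd a b := @convex_cone_add R Z K a b Kconv Kcone.
(* [G] lies in the epigraph of [v - v 0]; describing it by witnesses [x] avoids extended reals. *)
pose G w r := exists x, [/\ X x, K (w - g x) & f x - f x0 <= r].
have [||||u [ucont uG]] := @calm_subgradient R Z G M; first exact: ltW.
- by exists x0; split=> //; rewrite subrr.
- move=> w1 r1 w2 r2 t [x1 [X1 K1 f1]] [x2 [X2 K2 f2]] t01.
  have /andP[t0 t1] := t01; have s0 : 0 <= 1 - t by rewrite subr_ge0.
  exists (t *: x1 + (1 - t) *: x2); split; first exact: convex_setP.
    have := gconv _ _ _ X1 X2 t01; rewrite /preceq => gt.
    (* The slack at the combined point is the convexity gap of [g] plus the combination of the two
       slacks. *)
    have := Kadd _ _ gt (Kadd _ _ (Kcone _ _ t0 K1) (Kcone _ _ s0 K2)).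
    rewrite !scalerBr (addrACA (t *: w1)) -opprD.
    by rewrite [X in K X]addrC subrKA.
  have := convex_functionP fconv X1 X2 t01.
  have := ler_wpM2l t0 f1; have := ler_wpM2l s0 f2; nra.
- move=> w r [x [Xx Kx]]; apply: le_trans.
  have := le_trans (leeB (lexx (f x0)%:E) (value_function_le Xx Kx)).
  rewrite -v0 => /(_ _ (calm w)).
  by rewrite v0 -EFinB lee_fin; lra.
(* [G k 0] holds through [x0], since [k - g x0] is a sum of two elements of [K]. *)
have uK k : K k -> u k <= 0.
  move=> Kk; apply: uG; exists x0; split => //; last by rewrite subrr.
  by apply: Kadd => //; rewrite -sub0r.
have ux0 : u (g x0) = 0.
  apply/eqP; rewrite eq_le; apply/andP; split.
    apply: uG; exists x0; split => //; last by rewrite subrr.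
    by rewrite subrr -(scale0r (0 - g x0)); exact: Kcone.
  by have := uK _ x0K; rewrite sub0r linearN oppr_le0.
have uNcont : topological_dual (\- u : {linear Z -> R^o}).
  by move=> z; apply: cvgN; exact: ucont.
exists (\- u : {linear Z -> R^o}); split => //; exists x0; split => //=.
- split => // y Xy; rewrite ux0 oppr0 addr0.
  (* Minimality of the Lagrangian for [- u] is the bound on [u] at the point [(g y, f y - f x0)] of
     [G]. *)
  suff : u (g y) <= f y - f x0 by lra.
  apply: uG; exists y; split => //.
  by rewrite subrr -(scale0r (0 - g x0)); exact: Kcone.
- by rewrite ux0 oppr0.
- by split => // k /uK; rewrite oppr_ge0.
Qed.

End duality.

Theorem theorem3p4 (R : realType) (E Z : completeNormedModType R)
    (K : set Z) (X : set E) (f : E -> R) (g : E -> Z)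
    (K_closed : closed K) (K_convex : convex_set K) (K_cone : cone K)
    (K_interior : interior K !=set0)
    (X_convex : convex_set X) (f_convex : convex_function X f)
    (g_convex : cone_convex K X g)
    (P_solvable : optimal_solution K X f g !=set0) :
  let v := value_function K X f g in
  [<-> optimal_multipliers K X f g !=set0;
       subdifferential0 v !=set0;
       v 0 \is a fin_num /\
       exists2 M : R, 0 < M & forall z : Z, (v 0%R - v z <= (M * `|z|)%:E)%E].
Proof.
have [x0 x0opt] := P_solvable => v; tfae.
- move=> [u /(multiplier_subgradient x0opt) ?].
  by exists (\- u : {linear Z -> R^o}).
- by move=> [u uv]; split; [case: uv|exact: subgradient_calm uv].
- by move=> [_ [M M0 calm]]; exact: (calm_multiplier _ _ _ _ _ x0opt M0 calm).
Qed.
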